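(* Let $k$ and $\ell$ be positive integers, and let $G$ be a $(k,\ell)$-linearly divisible graph with $\omega(G)=\omega$. Then $\chi(G)\leq k\binom{\omega+1}{2}$.
   Context: All graphs are finite and simple; $\chi$ denotes chromatic number and $\omega$ denotes clique number. Two vertex-disjoint subgraphs are complete to one another if every vertex of one is adjacent to every vertex of the other. For a nonnegative integer $r$, $[r]=\{1,\dots,r\}$, with $[0]=\emptyset$. Let $k,\ell$ be positive integers and let $G'$ be a nonempty graph with $\omega(G')=\omega$. A partition $V(G')=V(G_1)\sqcup V(G_2)$, where $G_1$ and $G_2$ are (possibly empty) induced subgraphs of $G'$, is a $(k,\ell)$-linear division of $G'$ if there exist an integer $r\ge 0$ and $\alpha\in\{0,\dots,\min\{\ell,\omega\}\}$ such that: (1) $V(G_1)=V(D_1)\sqcup\cdots\sqcup V(D_r)$, where $D_1,\dots,D_r$ are nonempty induced subgraphs of $G'$ that are pairwise complete to one another, and $\omega(G_1)\le\omega-\alpha$. Moreover, if $r=1$, then $\alpha\ge 1$; if $r\ge 2$, then $\omega(D_i)\ge 2$ for every $i\in[r]$; while if $r=0$, then $G_1$ is empty and $\alpha=\min\{\ell,\omega\}$. (2) If $r\in\{0,1\}$, then $\chi(G_2)\le k\alpha\left(\omega-\frac{\alpha-1}{2}\right)$; if $r\ge 2$, then $\chi(G_2)\le k\left((\alpha+2r-2)\left(\omega-\frac{\alpha+2r}{2}\right)+\frac{3\alpha}{2}\right)$. A graph $G$ is $(k,\ell)$-linearly divisible if every (nonempty) connected induced subgraph of $G$ admits a $(k,\ell)$-linear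 division. *)

(* Defs.v *)
From mathcomp Require Import all_boot all_order all_algebra.
Set Implicit Arguments.
Unset Strict Implicit.
Unset Printing Implicit Defensive.

Import Order.TTheory GRing.Theory Num.Theory.
Local Open Scope ring_scope.

Record sgraph := SGraph {
  vertex :> finType;
  adj : rel vertex;
  adj_sym : symmetric adj;
  adj_irr : irreflexive adj }.

(* Every induced subgraph of G is represented by its vertex set S : {set G};  *)
(* G itself is [set: G].                                                      *)

Definition clique (G : sgraph) (C : {set G}) : bool :=
  [forall x in C, forall y in C, (x != y) ==> adj x y].

Definition omega (G : sgraph) (S : {set G}) : nat :=
  (\max_(C : {set G} | (C \subset S) && clique C) #|C|)%N.

(* Colourings are defined only on S, so that the empty subgraph is            *)
(* 0-colourable even when G is not empty.                                     *)
Definition colorable (G : sgraph) (S : {set G}) (n : nat) : bool :=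
  [exists f : {ffun {x : G | x \in S} -> 'I_n},
     [forall x, forall y, adj (val x) (val y) ==> (f x != f y)]].

Lemma colorable_exists (G : sgraph) (S : {set G}) : exists n, colorable S n.
Proof.
exists #|{: {x : G | x \in S}}|.
apply/existsP; exists [ffun x => enum_rank x].
apply/forallP => x; apply/forallP => y; apply/implyP => exy.
rewrite !ffunE; apply: contraTneq exy => /enum_rank_inj ->.
by rewrite adj_irr.
Qed.

Definition chi (G : sgraph) (S : {set G}) : nat := ex_minn (colorable_exists S).

Definition complete_to (G : sgraph) (A B : {set G}) : bool :=
  [forall x in A, forall y in B, adj x y].

Definition connected_in (G : sgraph) (S : {set G}) : bool :=
  [forall x in S, forall y in S,
     connect [rel u v | [&& u \in S, v \in S & adj u v]] x y].

(* The subtraction omega S - a does not truncate, as a <= omega S. The bounds *)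
(* on chi S2 are inequalities between rational numbers.                       *)
Definition linear_division (k l : nat) (G : sgraph) (S S1 S2 : {set G}) : Prop :=
  [/\ S1 :|: S2 = S, [disjoint S1 & S2] &
  exists (r a : nat) (D : 'I_r -> {set G}),
  let w := omega S in
  (a <= minn l w)%N /\
  [/\ S1 = \bigcup_(i < r) D i,
      forall i, D i != set0,
      forall i j, i != j -> [disjoint D i & D j] /\ complete_to (D i) (D j) &
      (omega S1 <= w - a)%N] /\
  [/\ r = 1%N -> (1 <= a)%N,
      (2 <= r)%N -> forall i, (2 <= omega (D i))%N &
      r = 0%N -> S1 = set0 /\ a = minn l w] /\
  ((r <= 1)%N ->
     (chi S2)%:R <= k%:R * a%:R * (w%:R - (a%:R - 1) / 2%:R) :> rat) /\
  ((2 <= r)%N ->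
     (chi S2)%:R <=
       k%:R * ((a%:R + 2%:R * r%:R - 2%:R) * (w%:R - (a%:R + 2%:R * r%:R) / 2%:R)
               + 3%:R * a%:R / 2%:R) :> rat)].

Definition linearly_divisible (k l : nat) (G : sgraph) : Prop :=
  forall S : {set G}, S != set0 -> connected_in S ->
  exists S1 S2 : {set G}, linear_division k l S S1 S2.

(* Main.v *)
Require Import Defs.
From mathcomp Require Import all_boot all_order all_algebra.
From mathcomp Require Import zify lra.

(** By strong induction on the clique number, every induced subgraph [S] can be
    coloured with [k * 'C(omega S + 1, 2)] colours.

    Colourings of the connected components can share one palette, so [S] may be
    taken connected ([colorable_connected]) and then has a linear division
    [S1], [S2] with parameters [r] and [a].  Write [w = omega S] and
    [f n = n (n + 1) / 2]; colour [S1] and [S2] with disjoint palettes.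

    If [r <= 1], the bound on [chi S2] is [k (w + (w - 1) + ... + (w - a + 1))],
    that is, [k (f w - f (w - a))], while [S1] needs at most [k * f (w - a)]
    colours: either it is empty, or [a >= 1] and induction applies to it.

    If [r >= 2], the parts [D i] have clique number at least 2, and because they
    are complete to one another their clique numbers add up to at most [w - a]
    ([sum_omega_le]).  As there are two parts or more, each has clique number
    smaller than [w], so induction colours [S1] with the sum of the
    [k * f (omega (D i))] colours.  By convexity of [f] this sum is largest when
    all clique numbers but one equal 2 ([sum_bin2_le]), so it is at most
    [k (3 (r - 1) + f (w - t))] with [t = a + 2 (r - 1)].  The bound on [chi S2]
    is exactly what is left: [f w - f (w - t) - 3 (r - 1)], times [k]. *)

Set Implicit Arguments.
Unset Strict Implicit.
Unset Printing Implicit Defensive.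

Import Order.TTheory GRing.Theory Num.Theory.

(** * Triangular numbers *)

Lemma double_bin2 n : 2 * 'C(n.+1, 2) = n.+1 * n.
Proof. by rewrite -mul_bin_diag /= bin1. Qed.

Lemma bin2_rat n : ('C(n.+1, 2)%:R = n%:R * (n%:R + 1) / 2%:R :> rat)%R.
Proof.
have /(congr1 (fun m => m%:R : rat)%R) := double_bin2 n.
by rewrite !natrM -[n.+1]addn1 natrD => ?; lra.
Qed.

Lemma bin2_pair_le x y :
  'C(x.+3, 2) + 'C(y.+3, 2) <= 3 + 'C((x + y).+3, 2).
Proof.
rewrite -(@leq_pmul2l 2) // (mulnDr 2 'C(x.+3, 2)) (mulnDr 2 3).
by rewrite !double_bin2; nia.
Qed.

(** Convexity of the triangular numbers: moving all the excess over 2 of the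
    numbers [b i + 2] into a single one does not decrease the sum; each of the
    [r] others then contributes ['C(3, 2) = 3]. *)
Lemma sum_bin2_le r (b : 'I_r.+1 -> nat) :
  \sum_i 'C((b i).+3, 2) <= 3 * r + 'C((\sum_i b i).+3, 2).
Proof.
elim: r b => [|r IHr] b; first by rewrite !big_ord1.
rewrite big_ord_recr [\sum_i b i]big_ord_recr /=.
have := IHr (fun i => b (widen_ord (leqnSn _) i)).
set x := \sum_i b _; set y := b ord_max => le_x.
apply: leq_trans (leq_add le_x (leqnn _)) _; rewrite -addnA mulnSr -addnA.
exact: leq_add (leqnn _) (bin2_pair_le _ _).
Qed.

Lemma ltn_sum_pos r (b : 'I_r -> nat) i :
  1 < r -> (forall j, 0 < b j) -> b i < \sum_j b j.
Proof.
move=> r_gt1 b_gt0.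
have [j ij] : exists j, j != i.
  have: 0 < #|predC1 i| by rewrite cardC1 card_ord -subn1 subn_gt0.
  by case/card_gt0P=> j; exists j.
rewrite (bigD1 i) //= (bigD1 j) //= -addn1 leq_add2l.
exact: leq_trans (b_gt0 j) (leq_addr _ _).
Qed.

Section Graph.
Variable G : sgraph.
Implicit Types (S T A B C : {set G}) (m n : nat).

(** * Colourings *)

(** Colourings as functions on all vertices, which can be glued along a
    partition. *)
Lemma colorableP S n :
  reflect (exists2 c : G -> nat, {in S, forall x, c x < n} &
             {in S &, forall x y, adj x y -> c x != c y})
          (colorable S n).
Proof.
apply: (iffP existsP) => [[f /forallP fP]|[c c_lt cP]].
  exists (fun x => if insub x is Some u then f u : nat else 0).
    by move=> x Sx; rewrite insubT.
  move=> x y Sx Sy xy; rewrite !insubT.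
  by have /forallP/(_ (Sub y Sy))/implyP/(_ xy) := fP (Sub x Sx).
exists [ffun u => Ordinal (c_lt (val u) (valP u))].
apply/forallP => u; apply/forallP => v; apply/implyP => uv.
by rewrite !ffunE -val_eqE /=; apply: cP; rewrite ?(valP u) ?(valP v).
Qed.

Lemma colorable_chi S : colorable S (chi S).
Proof. by rewrite /chi; case: ex_minnP. Qed.

Lemma chi_le S n : colorable S n -> chi S <= n.
Proof. by rewrite /chi; case: ex_minnP => m _; apply. Qed.

Lemma colorable_leq S m n : m <= n -> colorable S m -> colorable S n.
Proof.
move=> le_mn /colorableP[c c_lt cP]; apply/colorableP; exists c => // x Sx.
exact: leq_trans (c_lt x Sx) le_mn.
Qed.

Lemma colorable_set0 n : colorable (set0 : {set G}) n.
Proof. by apply/colorableP; exists (fun=> 0) => x; rewrite inE. Qed.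

Lemma colorableU A B m n :
  colorable A m -> colorable B n -> colorable (A :|: B) (m + n).
Proof.
move=> /colorableP[c c_lt cP] /colorableP[d d_lt dP]; apply/colorableP.
exists (fun x => if x \in A then c x else m + d x) => [x | x y]; rewrite !inE.
  case: ifP => /= [Ax _|_ Bx]; last by rewrite ltn_add2l d_lt.
  by rewrite (leq_trans (c_lt x Ax)) ?leq_addr.
case: ifP => /= [Ax _|_ Bx]; case: ifP => /= [Ay _|_ By] xy.
- exact: cP.
- by rewrite neq_ltn (leq_trans (c_lt x Ax)) ?leq_addr.
- by rewrite neq_ltn (leq_trans (c_lt y Ay)) ?leq_addr ?orbT.
- by rewrite eqn_add2l dP.
Qed.

Lemma colorable_bigcup r (D : 'I_r -> {set G}) (n : 'I_r -> nat) :
  (forall i, colorable (D i) (n i)) -> colorable (\bigcup_i D i) (\sum_i n i).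
Proof.
move=> colD; elim/big_ind2: _ => [|A m B p|//]; first exact: colorable_set0.
exact: colorableU.
Qed.

(** Without edges between [A] and [B], the two colourings can share their
    colours. *)
Lemma colorable_anticomplete A B n :
  {in A & B, forall x y, ~~ adj x y} ->
  colorable A n -> colorable B n -> colorable (A :|: B) n.
Proof.
move=> nAB /colorableP[c c_lt cP] /colorableP[d d_lt dP]; apply/colorableP.
exists (fun x => if x \in A then c x else d x) => [x | x y]; rewrite !inE.
  by case: ifP => /= [Ax _|_ Bx]; [apply: c_lt | apply: d_lt].
case: ifP => /= [Ax _|_ Bx]; case: ifP => /= [Ay _|_ By] xy.
- exact: cP.
- by have := nAB x y Ax By; rewrite xy.
- by have := nAB y x Ay Bx; rewrite adj_sym xy.
- exact: dP.
Qed.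

(** A disconnected [S] splits into the component of a vertex and the rest, two
    smaller sets without edges between them. *)
Lemma colorable_connected S n :
  (forall T, T \subset S -> T != set0 -> connected_in T -> colorable T n) ->
  colorable S n.
Proof.
have [m leSm] := ubnP #|S|; elim: m S leSm => // m IHm S leSm colS.
have [->|S0] := eqVneq S set0; first exact: colorable_set0.
have [|] := boolP (connected_in S); first exact: colS.
rewrite /connected_in; set e := (X in connect X).
case/forall_inPn=> x Sx /forall_inPn[y Sy nxy].
pose A := [set z in S | connect e x z].
have sAS : A \subset S by apply/subsetP => z; rewrite inE => /andP[].
have Ax : x \in A by rewrite inE Sx connect0.
have nAy : y \notin A by rewrite inE Sy.
have col T : T \proper S -> colorable T n.
  move=> pTS; apply: IHm => [|U sUT].
    by apply: leq_trans (proper_card pTS) _; rewrite -ltnS.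
  by apply: colS; apply: subset_trans sUT (proper_sub pTS).
rewrite -(setID S A) (setIidPr sAS); apply: colorable_anticomplete.
- move=> u v; rewrite !inE => /andP[Su xu] /andP[+ Sv]; rewrite Sv /=.
  apply: contra => uv; apply: connect_trans xu (connect1 _).
  by rewrite /e /= Su Sv.
- by apply: col; apply/properP; split=> //; exists y.
- apply: col; apply/properP; split; first exact: subsetDl.
  by exists x; rewrite // inE Ax.
Qed.

(** * Clique numbers *)

Lemma cliqueP C :
  reflect {in C &, forall x y, x != y -> adj x y} (clique C).
Proof.
apply: (iffP forall_inP) => cC x => [y Cx Cy xy|Cx].
  by have /forall_inP/(_ y Cy)/implyP := cC x Cx; apply.
by apply/forall_inP => y Cy; apply/implyP; apply: cC.
Qed.

Lemma leq_card_omega S C : C \subset S -> clique C -> #|C| <= omega S.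
Proof. by move=> sCS cC; apply: leq_bigmax_cond; rewrite sCS. Qed.

Lemma omegaP S : exists C, [/\ C \subset S, clique C & #|C| = omega S].
Proof.
pose P := [pred C : {set G} | (C \subset S) && clique C].
have P0 : 0 < #|P|.
  apply/card_gt0P; exists set0; rewrite inE sub0set.
  by apply/cliqueP => x; rewrite inE.
have [C /andP[sCS cC] maxC] := eq_bigmax_cond (fun C : {set G} => #|C|) P0.
by exists C.
Qed.

Lemma omegaS S T : T \subset S -> omega T <= omega S.
Proof.
move=> sTS; have [C [sCT cC <-]] := omegaP T.
exact: leq_card_omega (subset_trans sCT sTS) cC.
Qed.

(** Cliques in parts that are pairwise complete unite to a clique. *)
Lemma sum_omega_le r (D : 'I_r -> {set G}) :
  (forall i j, i != j -> [disjoint D i & D j] /\ complete_to (D i) (D j)) ->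
  \sum_i omega (D i) <= omega (\bigcup_i D i).
Proof.
move=> compD; have /fin_all_exists[C CP] := fun i => omegaP (D i).
have -> : \sum_i omega (D i) = #|\bigcup_i C i|.
  rewrite -sum1_card partition_disjoint_bigcup => [|i j ij].
    by apply: eq_bigr => i _; rewrite sum1_card; case: (CP i).
  have [sCi _ _] := CP i; have [sCj _ _] := CP j.
  exact: disjointWl sCi (disjointWr sCj (compD i j ij).1).
apply: leq_card_omega.
  by apply/bigcupsP => i _; have [sCi _ _] := CP i; apply: (bigcup_max i).
apply/cliqueP => x y /bigcupP[i _ Cx] /bigcupP[j _ Cy] xy.
have [sCi /cliqueP cCi _] := CP i; have [sCj _ _] := CP j.
have [eij|ij] := eqVneq i j; first by apply: cCi; rewrite // eij.
have [_ /forall_inP/(_ x (subsetP sCi x Cx))/forall_inP] := compD i j ij.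
by apply; apply: (subsetP sCj).
Qed.

(** * Linear divisions *)

(** The induction step.  The sets that the hypothesis is applied to
    are [S1] itself when [r = 1] and the [D i] when [r >= 2]; the palette of
    [S2] then fills the bound up exactly, in both cases by an identity between
    quadratic polynomials in [w], [a] and [r]. *)
Lemma linear_division_colorable k l S S1 S2 :
  linear_division k l S S1 S2 ->
  (forall T, omega T < omega S -> colorable T (k * 'C((omega T).+1, 2))) ->
  colorable S (k * 'C((omega S).+1, 2)).
Proof.
case=> <- _ [r [a [D]]] /=; set w := omega _.
case=> le_a [[defS1 _ compD leS1] [[a_gt0 D2 r0] [chi_le1 chi_ge2]]] IH.
have le_aw : a <= w by apply: leq_trans le_a (geq_minr _ _).
suff [n colS1 le_n] :
    exists2 n, colorable S1 n & n + chi S2 <= k * 'C(w.+1, 2).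
  exact: colorable_leq le_n (colorableU colS1 (colorable_chi S2)).
have [r_le1 | r_gt1] := leqP r 1.
  exists (k * 'C((w - a).+1, 2)).
    case: (posnP r) => [/r0[-> _]|r_gt0]; first exact: colorable_set0.
    have {}a_gt0 : 0 < a by apply/a_gt0/eqP; rewrite eqn_leq r_le1.
    have ltS1 : omega S1 < w by lia.
    apply: colorable_leq (IH _ ltS1).
    by rewrite leq_mul2l leq_bin2l ?orbT // ltnS.
  rewrite -(ler_nat rat) natrD !natrM !bin2_rat natrB //.
  by have := chi_le1 r_le1; lra.
have {}D2 := D2 r_gt1; have sumD := sum_omega_le compD.
rewrite -defS1 in sumD; have {leS1} sumDw := leq_trans sumD leS1.
exists (\sum_i k * 'C((omega (D i)).+1, 2)).
  rewrite defS1; apply: colorable_bigcup => i; apply: IH.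
  apply: leq_trans (leq_trans sumDw (leq_subr _ _)).
  by apply: ltn_sum_pos => // j; apply: ltnW.
case: r => // r in D r_gt1 D2 sumDw {defS1 compD a_gt0 r0 chi_le1 sumD} chi_ge2 *.
have sumE : \sum_i omega (D i) = \sum_i (omega (D i) - 2) + 2 * r.+1.
  under eq_bigr => i _ do rewrite -(subnK (D2 i)).
  by rewrite big_split /= sum_nat_const card_ord mulnC.
(* All parts but one have clique number 2 in the extremal case; [r] has become
   the number of these parts, and the last one has [w - a - 2 * r] left. *)
have le_bin :
    \sum_i 'C((omega (D i)).+1, 2) <= 3 * r + 'C((w - (a + 2 * r)).+1, 2).
  under eq_bigr => i _ do rewrite -(subnK (D2 i)) addn2.
  apply: leq_trans (sum_bin2_le _) _; rewrite leq_add2l leq_bin2l //; lia.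
rewrite -big_distrr /=.
apply: leq_trans (leq_add (leq_mul (leqnn k) le_bin) (leqnn _)) _.
rewrite -(ler_nat rat) natrD !natrM (natrD _ (3 * r)) natrM !bin2_rat.
rewrite natrB ?natrD ?natrM; last by lia.
by have := chi_ge2 r_gt1; rewrite -[r.+1]addn1 !(natrD, natrM); lra.
Qed.

End Graph.

Theorem theorem1p2 (k l : nat) (hk : (0 < k)%N) (hl : (0 < l)%N)
    (G : sgraph) (hG : linearly_divisible k l G)
    (w : nat) (hw : omega [set: G] = w) :
  (chi [set: G] <= k * 'C(w.+1, 2))%N.
Proof.
rewrite -{}hw; apply: chi_le; move: [set: G] => S.
have [n ltSn] := ubnP (omega S); elim: n => // n IHn in S ltSn *.
apply: colorable_connected => T sTS T0 cT; have [S1 [S2 divT]] := hG T T0 cT.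
have leTS := omegaS sTS.
apply: colorable_leq (linear_division_colorable divT _).
  by rewrite leq_mul2l leq_bin2l ?orbT.
by move=> U ltUT; apply: IHn; apply: leq_trans ltUT (leq_trans leTS _).
Qed.
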